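(* Let $G$ be a group, $\mathcal F$ a set of subgroups of $G$ and $R$ a commutative ring. Let $f\colon X\to Y$ be a map of simplicial $G$-sets such that the stabilizer of every simplex of $X$ and of $Y$ belongs to $\mathcal F$. Then the induced map of normalized chain complexes $C(f;R)\colon C(X;R)\to C(Y;R)$ is a $G$-equivariant chain homotopy equivalence in each of the following situations: (a) the induced map $C(X;R)^H\to C(Y;R)^H$ on $H$-invariants is a quasi-isomorphism for all $H\in\mathcal F$; (b) the induced map $C(X^H;R)\to C(Y^H;R)$ is a quasi-isomorphism for all $H\in\mathcal F$.
   Context: $C(-;R)$ denotes the normalized chain complex functor from simplicial sets to non-negatively graded chain complexes of $R$-modules, applied levelwise to $G$-objects; $C(X;R)^H$ is the subcomplex of $H$-invariants; $X^H$ is the simplicial set of $H$-fixed simplices. *)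

(* Defs.v *)
From HB Require Import structures.
From mathcomp Require Import all_boot all_algebra.
From Stdlib Require Import ClassicalEpsilon.
Set Implicit Arguments. Unset Strict Implicit. Unset Printing Implicit Defensive.
Import GRing.Theory.
Local Open Scope ring_scope.

Record grp := Grp {
  gcar :> Type;
  gmul : gcar -> gcar -> gcar;
  gone : gcar;
  ginv : gcar -> gcar;
  gmulA : forall a b c, gmul a (gmul b c) = gmul (gmul a b) c;
  gmul1g : forall a, gmul gone a = a;
  gmulVg : forall a, gmul (ginv a) a = gone }.

Definition is_subgroup (G : grp) (H : G -> Prop) : Prop :=
  [/\ H (gone G), (forall a b, H a -> H b -> H (gmul a b)) &
      (forall a, H a -> H (ginv a))].

Record ssdata := SSData {
  sim : nat -> Type;
  face : forall n, nat -> sim n.+1 -> sim n; (* d_i : X_{n+1} -> X_n, 0<=i<=n+1 *)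
  degen : forall n, nat -> sim n -> sim n.+1 (* s_j : X_n -> X_{n+1}, 0<=j<=n *)
}.

Definition simplicial_identities (X : ssdata) : Prop :=
  [/\ (forall n i j (x : sim X n.+2), (i < j)%N -> (j <= n.+2)%N ->
         face i (face j x) = face j.-1 (face i x)),
      (forall n i j (x : sim X n), (j <= n)%N -> (i == j) || (i == j.+1) ->
         face i (degen j x) = x),
      (forall n i j (x : sim X n.+1), (i < j)%N -> (j <= n.+1)%N ->
         face i (degen j x) = degen j.-1 (face i x)),
      (forall n i j (x : sim X n.+1), (j.+1 < i)%N -> (i <= n.+2)%N ->
         face i (degen j x) = degen j (face i.-1 x)) &
      (forall n i j (x : sim X n), (i <= j)%N -> (j <= n)%N ->
         degen i (degen j x) = degen j.+1 (degen i x))].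

Unset Implicit Arguments.
Record sGset (G : grp) := SGset {
  sdata :> ssdata;
  sact : forall n, G -> sim sdata n -> sim sdata n;
  sGset_simplicial : simplicial_identities sdata;
  sact1 : forall n (x : sim sdata n), sact n (gone G) x = x;
  sactM : forall n a b (x : sim sdata n), sact n (gmul a b) x = sact n a (sact n b x);
  sact_face : forall n i a (x : sim sdata n.+1), (i <= n.+1)%N ->
      sact n a (face i x) = face i (sact n.+1 a x);
  sact_degen : forall n j a (x : sim sdata n), (j <= n)%N ->
      sact n.+1 a (degen j x) = degen j (sact n a x) }.

Set Implicit Arguments.
Arguments sact {G} s n a x : rename.

Unset Implicit Arguments.
Record sGmap (G : grp) (X Y : sGset G) := SGmap {
  smap :> forall n, sim X n -> sim Y n;
  smap_face : forall n i (x : sim X n.+1), (i <= n.+1)%N ->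
      smap n (face i x) = face i (smap n.+1 x);
  smap_degen : forall n j (x : sim X n), (j <= n)%N ->
      smap n.+1 (degen j x) = degen j (smap n x);
  smap_equiv : forall n a (x : sim X n), smap n (sact X n a x) = sact Y n a (smap n x) }.
Set Implicit Arguments.
Arguments smap {G X Y} s n x : rename.
Arguments sGmap {G} X Y.

Definition stab (G : grp) (X : sGset G) n (x : sim X n) : G -> Prop :=
  fun a => sact X n a x = x.

Definition ceq (T : Type) (x y : T) : bool :=
  if excluded_middle_informative (x = y) then true else false.

(* a chain is a finite formal R-linear combination of simplices *)
Definition chain (R : Type) (T : Type) := seq (T * R).

Definition coef (R : comPzRingType) (T : Type) (c : chain R T) (x : T) : R :=
  \sum_(p <- c | ceq p.1 x) p.2.

Definition cscale (R : comPzRingType) (T : Type) (r : R) (c : chain R T) : chain R T :=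
  [seq (p.1, r * p.2) | p <- c].

Definition cmap (R : Type) (T U : Type) (f : T -> U) (c : chain R T) : chain R U :=
  [seq (f p.1, p.2) | p <- c].

Definition lin (R : comPzRingType) (T U : Type) (g : T -> chain R U) (c : chain R T)
  : chain R U := flatten [seq cscale p.2 (g p.1) | p <- c].

Definition unit_chain (R : comPzRingType) (T : Type) (x : T) : chain R T := [:: (x, 1)].

Definition degenerate (X : ssdata) (n : nat) : sim X n -> Prop :=
  match n return sim X n -> Prop with
  | 0 => fun _ => False
  | m.+1 => fun x => exists j (y : sim X m), (j <= m)%N /\ x = degen j y
  end.

(* equality in the normalized chain module C_n(X;R) = R[X_n] / (degenerate simplices):
   equal coefficients on every non-degenerate simplex *)
Definition ceqv (R : comPzRingType) (X : ssdata) n (c c' : chain R (sim X n)) : Prop :=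
  forall x, ~ degenerate x -> coef c x = coef c' x.

Definition bd (R : comPzRingType) (X : ssdata) n (c : chain R (sim X n.+1))
  : chain R (sim X n) :=
  lin (fun x => [seq (face i x, (-1) ^+ i) | i <- iota 0 n.+2]) c.

Definition scycle (R : comPzRingType) (X : ssdata) n : chain R (sim X n) -> Prop :=
  match n return chain R (sim X n) -> Prop with
  | 0 => fun _ => True
  | m.+1 => fun c => ceqv (bd c) [::]
  end.

(* phi : A -> B is a map of subcomplexes (given by predicates P of A and Q of B)
   inducing an isomorphism on all homology groups *)
Definition quasi_iso_sub (R : comPzRingType) (X Y : ssdata)
  (P : forall n, chain R (sim X n) -> Prop) (Q : forall n, chain R (sim Y n) -> Prop)
  (phi : forall n, chain R (sim X n) -> chain R (sim Y n)) : Prop :=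
  (forall n (b : chain R (sim Y n)), Q n b -> scycle b ->
     exists a, [/\ P n a, scycle a &
       exists b', Q n.+1 b' /\ ceqv (phi n a) (b ++ bd b')]) /\
  (forall n (a : chain R (sim X n)), P n a -> scycle a ->
     (exists b', Q n.+1 b' /\ ceqv (phi n a) (bd b')) ->
     exists a', P n.+1 a' /\ ceqv a (bd a')).

Definition quasi_iso (R : comPzRingType) (X Y : ssdata)
  (phi : forall n, chain R (sim X n) -> chain R (sim Y n)) : Prop :=
  quasi_iso_sub (fun _ _ => True) (fun _ _ => True) phi.

Definition Cmap (R : comPzRingType) (X Y : ssdata) (f : forall n, sim X n -> sim Y n) n
  : chain R (sim X n) -> chain R (sim Y n) := cmap (f n).

Definition inv_chain (R : comPzRingType) (G : grp) (X : sGset G) (H : G -> Prop) n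
  (c : chain R (sim X n)) : Prop :=
  forall a, H a -> ceqv (cmap (sact X n a) c) c.

Definition fixed (G : grp) (X : sGset G) (H : G -> Prop) n (x : sim X n) : Prop :=
  forall a, H a -> sact X n a x = x.

(* out-of-range indices are replaced by 0 (junk values, never used) *)
Definition fidx (n i : nat) : nat := if (i <= n)%N then i else 0%N.

Lemma fidx_le n i : (fidx n i <= n)%N.
Proof. rewrite /fidx; case: ifP => //. Qed.

Lemma fixed_face (G : grp) (X : sGset G) (H : G -> Prop) n i (x : sim X n.+1) :
  fixed H x -> fixed H (face (fidx n.+1 i) x).
Proof.
move=> fx a Ha; rewrite sact_face ?fidx_le //.
by rewrite fx.
Qed.

Lemma fixed_degen (G : grp) (X : sGset G) (H : G -> Prop) n j (x : sim X n) :
  fixed H x -> fixed H (degen (fidx n j) x).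
Proof.
move=> fx a Ha; rewrite sact_degen ?fidx_le //.
by rewrite fx.
Qed.

Definition fixX (G : grp) (X : sGset G) (H : G -> Prop) : ssdata :=
  @SSData (fun n => {x : sim X n | fixed H x})
    (fun n i x => exist _ _ (fixed_face i (proj2_sig x)))
    (fun n j x => exist _ _ (fixed_degen j (proj2_sig x))).

Lemma fixed_map (G : grp) (X Y : sGset G) (f : sGmap X Y) (H : G -> Prop) n
  (x : sim X n) : fixed H x -> fixed H (f n x).
Proof. by move=> fx a Ha; rewrite -smap_equiv fx. Qed.

Definition fixmap (G : grp) (X Y : sGset G) (f : sGmap X Y) (H : G -> Prop) n
  (x : sim (fixX X H) n) : sim (fixX Y H) n :=
  exist _ _ (fixed_map f (proj2_sig x)).

(* An R-linear map C_n(Y) -> C_{n+k}(X) is given by its values on simplices,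
   which must vanish on degenerate simplices (C_n(Y) is free on the
   non-degenerate simplices). *)
Definition lin_equiv (R : comPzRingType) (G : grp) (X Y : sGset G) (k : nat)
  (g : forall n, sim Y n -> chain R (sim X (k + n))) : Prop :=
  (forall n (y : sim Y n), degenerate y -> ceqv (g n y) [::]) /\
  (forall n a (y : sim Y n), ceqv (g n (sact Y n a y)) (cmap (sact X (k + n) a) (g n y))).

Definition chain_map_on (R : comPzRingType) (X Y : ssdata)
  (g : forall n, sim Y n -> chain R (sim X (0 + n))) : Prop :=
  forall n (y : sim Y n.+1), ceqv (bd (g n.+1 y)) (lin (g n) (bd (unit_chain R y))).

Definition homotopy_id (R : comPzRingType) (X : ssdata)
  (gphi : forall n, sim X n -> chain R (sim X (0 + n)))
  (h : forall n, sim X n -> chain R (sim X (1 + n))) : Prop :=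
  (forall x : sim X 0,
     ceqv (gphi 0 x ++ [:: (x, -1)]) (bd (h 0 x))) /\
  (forall n (x : sim X n.+1),
     ceqv (gphi n.+1 x ++ [:: (x, -1)]) (bd (h n.+1 x) ++ lin (h n) (bd (unit_chain R x)))).

Definition equiv_htpy_equivalence (R : comPzRingType) (G : grp) (X Y : sGset G)
  (f : sGmap X Y) : Prop :=
  exists (g : forall n, sim Y n -> chain R (sim X (0 + n)))
         (hX : forall n, sim X n -> chain R (sim X (1 + n)))
         (hY : forall n, sim Y n -> chain R (sim Y (1 + n))),
    [/\ lin_equiv g, chain_map_on g, lin_equiv hX, lin_equiv hY &
        homotopy_id (fun n x => g n (f n x)) hX /\
        homotopy_id (fun n y => Cmap f (g n y)) hY].

(* Main.v *)
(* The normalized chains are free on the nondegenerate simplices, so an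
   equivariant map out of them may be prescribed on orbit representatives, the
   value at x being any chain invariant under the stabilizer of x.  Hence a
   complex of this kind whose H-invariants are acyclic for every stabilizer H
   has an equivariant contraction, built degree by degree.  Part (a) follows by
   applying this to the mapping cone of f and reading off the components of the
   contraction.  For part (b) the same argument works with the invariant chains
   replaced by the smaller family of chains supported on H-fixed simplices,
   which is stable under every equivariant map with values in that family. *)

Require Import Defs.
From HB Require Import structures.
From mathcomp Require Import all_boot all_algebra ring.
From Stdlib Require Import ClassicalEpsilon FunctionalExtensionality.
From Stdlib Require Import PropExtensionality.
Set Implicit Arguments. Unset Strict Implicit. Unset Printing Implicit Defensive.
Import GRing.Theory.
Local Open Scope ring_scope.

(** * Finite formal linear combinations *)

Section Chains.
Variable R : comPzRingType.
Implicit Types T U V : Type.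

Lemma ceqP T (x y : T) : reflect (x = y) (ceq x y).
Proof. by rewrite /ceq; case: excluded_middle_informative => h; constructor. Qed.

Lemma coef_nil T (x : T) : coef [::] x = 0 :> R.
Proof. by rewrite /coef big_nil. Qed.

Lemma coef_cons T (p : T * R) c x :
  coef (p :: c) x = (if ceq p.1 x then p.2 else 0) + coef c x.
Proof. by rewrite /coef big_cons; case: ifP => _ //; rewrite add0r. Qed.

Lemma coef_cat T (c c' : chain R T) x : coef (c ++ c') x = coef c x + coef c' x.
Proof. by rewrite /coef big_cat. Qed.

Lemma coef_scale T r (c : chain R T) x : coef (cscale r c) x = r * coef c x.
Proof. by rewrite /coef /cscale big_map /= mulr_sumr. Qed.

Lemma coef_unit T (x y : T) : coef (unit_chain R x) y = (ceq x y)%:R.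
Proof. by rewrite coef_cons coef_nil addr0; case: ifP. Qed.

Lemma coef_lin T U (g : T -> chain R U) c y :
  coef (lin g c) y = \sum_(p <- c) p.2 * coef (g p.1) y.
Proof.
elim: c => [|p c IH]; first by rewrite coef_nil big_nil.
by rewrite /lin /= coef_cat coef_scale -/(lin g c) IH big_cons.
Qed.

Lemma cscale1 T (c : chain R T) : cscale 1 c = c.
Proof. by elim: c => [|[x r] c IH] //=; rewrite mul1r IH. Qed.

Lemma unit_chainN T (x : T) : [:: (x, -1)] = cscale (-1) (unit_chain R x).
Proof. by rewrite /cscale /= mulr1. Qed.

Lemma cscale_cscale T r s (c : chain R T) : cscale r (cscale s c) = cscale (r * s) c.
Proof. by elim: c => [|[x t] c IH] //=; rewrite mulrA IH. Qed.

Lemma cscale_cat T r (c c' : chain R T) :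
  cscale r (c ++ c') = cscale r c ++ cscale r c'.
Proof. exact: map_cat. Qed.

Lemma lin_cat T U (g : T -> chain R U) c c' : lin g (c ++ c') = lin g c ++ lin g c'.
Proof. by rewrite /lin map_cat flatten_cat. Qed.

Lemma lin_nil T U (g : T -> chain R U) : lin g [::] = [::]. Proof. by []. Qed.

Lemma lin_cons T U (g : T -> chain R U) x r c :
  lin g ((x, r) :: c) = cscale r (g x) ++ lin g c.
Proof. by []. Qed.

Lemma lin_unit T U (g : T -> chain R U) x : lin g (unit_chain R x) = g x.
Proof. by rewrite lin_cons cats0 cscale1. Qed.

Lemma lin_scale T U (g : T -> chain R U) r c : lin g (cscale r c) = cscale r (lin g c).
Proof.
elim: c => [|[x s] c IH] //=.
by rewrite !lin_cons IH cscale_cat cscale_cscale.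
Qed.

Lemma lin_lin T U V (g : U -> chain R V) (h : T -> chain R U) c :
  lin g (lin h c) = lin (fun x => lin g (h x)) c.
Proof.
by elim: c => [|[x r] c IH] //; rewrite !lin_cons lin_cat IH lin_scale.
Qed.

Lemma cmap_lin T U V (f : U -> V) (g : T -> chain R U) c :
  cmap f (lin g c) = lin (fun x => cmap f (g x)) c.
Proof.
elim: c => [|[x r] c IH] //; rewrite !lin_cons -IH /cmap /cscale map_cat -!map_comp.
by [].
Qed.

Lemma lin_cmap T U V (g : U -> chain R V) (f : T -> U) c :
  lin g (cmap f c) = lin (fun x => g (f x)) c.
Proof. by elim: c => [|[x r] c IH] //; rewrite /= !lin_cons IH. Qed.

Lemma cmapE T U (f : T -> U) c : cmap f c = lin (fun x => unit_chain R (f x)) c.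
Proof. by elim: c => [|[x r] c IH] //; rewrite lin_cons -IH /= mulr1. Qed.

Lemma cmap_cmap T U V (f : U -> V) (g : T -> U) (c : chain R T) :
  cmap f (cmap g c) = cmap (fun x => f (g x)) c.
Proof. by rewrite /cmap -map_comp. Qed.

Lemma cmap_cat T U (f : T -> U) (c c' : chain R T) :
  cmap f (c ++ c') = cmap f c ++ cmap f c'.
Proof. exact: map_cat. Qed.

Lemma cmap_scale T U (f : T -> U) r (c : chain R T) :
  cmap f (cscale r c) = cscale r (cmap f c).
Proof. by rewrite /cmap /cscale -!map_comp. Qed.

Lemma coef_filter_neq T (c : chain R T) x y :
  coef [seq p <- c | ~~ ceq p.1 x] y = if ceq x y then 0 else coef c y.
Proof.
elim: c => [|[z r] c IH] /=; first by rewrite coef_nil; case: ifP.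
rewrite coef_cons /=; case: (ceqP z x) => [->|nzx] /=; rewrite ?coef_cons /= IH.
  by case: ifP => // _; rewrite add0r.
by case: (ceqP x y) => [<-|//]; case: (ceqP z x) => // _; rewrite addr0.
Qed.

(** Induction on the length of the list: the entries at the first basis element, possibly scattered
    over the list, add up to a single coefficient, and filtering them out leaves all other
    coefficients unchanged. *)
Lemma sum_eq0 T (phi : T -> R) (c : chain R T) :
  (forall x, coef c x * phi x = 0) -> \sum_(p <- c) p.2 * phi p.1 = 0.
Proof.
have [n] := ubnP (size c); elim: n c => // n IH [|[x r] c] sz c0; first by rewrite big_nil.
rewrite (bigID (fun p => ceq p.1 x)) /=.
have -> : \sum_(p <- (x, r) :: c | ceq p.1 x) p.2 * phi p.1 = coef ((x, r) :: c) x * phi x.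
  by rewrite /coef mulr_suml; apply: eq_bigr => p /ceqP ->.
rewrite c0 add0r -big_filter; apply: IH.
  rewrite /=; case: (ceqP x x) => //= _.
  by rewrite size_filter; apply: leq_ltn_trans (count_size _ _) _.
by move=> y; rewrite coef_filter_neq; case: ifP => _; rewrite ?mul0r ?c0.
Qed.

End Chains.

Lemma skolem (A : Type) (B : A -> Type) (P : forall x, B x -> Prop) :
  (forall x, exists y, P x y) -> exists f, forall x, P x (f x).
Proof.
move=> h; exists (fun x => proj1_sig (constructive_indefinite_description _ (h x))).
by move=> x; case: constructive_indefinite_description.
Qed.

(** * Free modules on G-sets *)

Section GBases.
Variable G : grp.

Lemma gmulgV (a : G) : gmul a (ginv a) = gone G.
Proof.
rewrite -[LHS]gmul1g -{1}(gmulVg (ginv a)) -gmulA (gmulA (ginv a) a).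
by rewrite gmulVg gmul1g gmulVg.
Qed.

(* The null elements are those that vanish in the free module under
   consideration: the degenerate simplices. *)
Record gbasis := GBasis {
  gsort :> Type;
  gnull : gsort -> Prop;
  gact : G -> gsort -> gsort;
  gact1 : forall x, gact (gone G) x = x;
  gactM : forall a b x, gact (gmul a b) x = gact a (gact b x);
  gnull_act : forall a x, gnull x -> gnull (gact a x) }.

Definition gstab (T : gbasis) (x : T) : G -> Prop := fun a => gact a x = x.

Lemma gactK (T : gbasis) a (x : T) : gact (ginv a) (gact a x) = x.
Proof. by rewrite -gactM gmulVg gact1. Qed.

Lemma gactVK (T : gbasis) a (x : T) : gact a (gact (ginv a) x) = x.
Proof. by rewrite -gactM gmulgV gact1. Qed.

(** The representative of x is picked by [epsilon] from the predicate describing the orbit of x. By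
    functional and propositional extensionality this predicate is the same for x and its translates,
    so the choice is constant on orbits. *)
Lemma orbit_repr (T : gbasis) : exists (rep : T -> T) (tr : T -> G),
  (forall x, gact (tr x) (rep x) = x) /\ (forall a x, rep (gact a x) = rep x).
Proof.
case: (excluded_middle_informative (inhabited T)) => [i|ni]; last first.
  by exists (fun x => x), (fun=> gone G); split=> [x|a x]; case: ni.
pose rep (x : T) := epsilon i (fun y => exists a, gact a y = x).
have repP x : exists a, gact a (rep x) = x.
  apply: (epsilon_spec i (fun y => exists a, gact a y = x)).
  by exists x, (gone G); rewrite gact1.
exists rep, (fun x => proj1_sig (constructive_indefinite_description _ (repP x))).
split=> [x|a x]; first by case: constructive_indefinite_description.
congr (epsilon i _); apply: functional_extensionality => y.
apply: propositional_extensionality; split=> -[b bP].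
  by exists (gmul (ginv a) b); rewrite gactM bP gactK.
by exists (gmul a b); rewrite gactM bP.
Qed.

Variable R : comPzRingType.
Implicit Types (T U V : gbasis) (H : G -> Prop).

Definition eqv T (c c' : chain R T) := forall x, ~ gnull x -> coef c x = coef c' x.

Lemma eqv_refl T (c : chain R T) : eqv c c. Proof. by []. Qed.

Lemma eqv_sym T (c c' : chain R T) : eqv c c' -> eqv c' c.
Proof. by move=> e x nx; rewrite e. Qed.

Lemma eqv_trans T (c1 c2 c3 : chain R T) : eqv c1 c2 -> eqv c2 c3 -> eqv c1 c3.
Proof. by move=> e e' x nx; rewrite e ?e'. Qed.

Lemma eqv_unit_null T r (x : T) : gnull x -> eqv [:: (x, r)] [::].
Proof.
move=> nx y ny; rewrite coef_cons; case: ceqP => [xy|_]; last by rewrite add0r.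
by case: ny; rewrite -xy.
Qed.

Lemma eq_lin T U (g h : T -> chain R U) c :
  (forall x, eqv (g x) (h x)) -> eqv (lin g c) (lin h c).
Proof. by move=> gh x nx; rewrite !coef_lin; apply: eq_bigr => p _; rewrite gh. Qed.

Definition kills_null T U (g : T -> chain R U) := forall x, gnull x -> eqv (g x) [::].

(** The difference of c and c' has coefficient zero at every non-null element and g vanishes at the
    null ones, so every product required by [sum_eq0] is zero. *)
Lemma lin_eqv T U (g : T -> chain R U) c c' :
  kills_null g -> eqv c c' -> eqv (lin g c) (lin g c').
Proof.
move=> g0 e y ny; apply/eqP; rewrite -subr_eq0 -mulN1r -coef_scale -lin_scale.
rewrite -coef_cat -lin_cat coef_lin; apply/eqP.
apply: (sum_eq0 (phi := fun x => coef (g x) y)) => x.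
case: (excluded_middle_informative (gnull x)) => nx.
  by rewrite g0 // coef_nil mulr0.
by rewrite coef_cat coef_scale e // mulN1r subrr mul0r.
Qed.

(** Under these conditions [lin g] descends to an equivariant linear map between the free modules on
    the non-null elements. *)
Definition equivar T U (g : T -> chain R U) :=
  kills_null g /\ (forall a x, eqv (g (gact a x)) (cmap (gact a) (g x))).

Lemma gact_eqv T a (c c' : chain R T) :
  eqv c c' -> eqv (cmap (gact a) c) (cmap (gact a) c').
Proof.
rewrite !cmapE; apply: lin_eqv => x nx.
exact/eqv_unit_null/gnull_act.
Qed.

Lemma coef_gact T a (c : chain R T) x :
  coef (cmap (gact a) c) x = coef c (gact (ginv a) x).
Proof.
elim: c => [|[y r] c IH]; rewrite ?coef_nil // !coef_cons IH /=; congr (_ + _).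
case: ceqP => [<-|ne]; first by rewrite gactK; case: ceqP.
by case: ceqP => // e; case: ne; rewrite e gactVK.
Qed.

Lemma lin_equivar T U (g : T -> chain R U) a c : equivar g ->
  eqv (lin g (cmap (gact a) c)) (cmap (gact a) (lin g c)).
Proof. by move=> [_ ga]; rewrite lin_cmap cmap_lin; apply: eq_lin => x; apply: ga. Qed.

(** * Families of invariant chains *)

Definition inv T H (c : chain R T) := forall a, H a -> eqv (cmap (gact a) c) c.

(** Testing coefficients instead of list entries makes the condition stable under [eqv]: null
    elements and cancelling entries do not count. *)
Definition supp T H (c : chain R T) :=
  forall x, ~ gnull x -> coef c x <> 0 -> forall a, H a -> gact a x = x.

(* The two instances of D are the H-invariant chains, for part (a), and the
   chains on H-fixed simplices, for part (b). *)
Record invariant_family (D : forall T : gbasis, (G -> Prop) -> chain R T -> Prop) : Prop :=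
  InvariantFamily {
  fam_supp : forall T H (c : chain R T), supp H c -> D T H c;
  fam_inv : forall T H (c : chain R T), D T H c -> inv H c;
  fam_eqv : forall T H (c c' : chain R T), eqv c c' -> D T H c -> D T H c';
  fam_cat : forall T H (c c' : chain R T), D T H c -> D T H c' -> D T H (c ++ c');
  fam_lin : forall T U H (g : T -> chain R U) c, equivar g ->
    (forall x, D U (gstab x) (g x)) -> D T H c -> D U H (lin g c);
  fam_act : forall T H H' a (c : chain R T), D T H c ->
    (forall b, H' b -> H (gmul (ginv a) (gmul b a))) -> D T H' (cmap (gact a) c) }.

(** Take a in H. If c has a nonzero coefficient at x or at its translate by [ginv a], that element
    is fixed by a and the two coincide; otherwise both coefficients vanish. *)
Lemma supp_inv T H (c : chain R T) : supp H c -> inv H c.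
Proof.
move=> sc a Ha x nx; rewrite coef_gact.
have nx' : ~ gnull (gact (ginv a) x) by move/(gnull_act a); rewrite gactVK.
case: (eqVneq (coef c x) 0) => [c0|/eqP c0]; last by rewrite -{1}(sc x nx c0 a Ha) gactK.
case: (eqVneq (coef c (gact (ginv a) x)) 0) => [->//|/eqP c1].
by have := sc _ nx' c1 a Ha; rewrite gactVK => {1}<-.
Qed.

Lemma inv_family : invariant_family inv.
Proof.
split=> //.
- exact: supp_inv.
- move=> T H c c' e ic a Ha; apply: eqv_trans (gact_eqv a (eqv_sym e)) _.
  exact: eqv_trans (ic a Ha) e.
- by move=> T H c c' ic ic' a Ha x nx; rewrite cmap_cat !coef_cat ic ?ic'.
- move=> T U H g c eg _ ic a Ha; apply: eqv_trans (eqv_sym (lin_equivar a c eg)) _.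
  exact: lin_eqv eg.1 (ic a Ha).
(* As b a = a (a^-1 b a), translating by b after a amounts to applying first the conjugate, which
   lies in H and preserves c. *)
- move=> T H H' a c ic HH b Hb.
  apply: eqv_trans (gact_eqv a (ic _ (HH b Hb))); rewrite !cmap_cmap.
  by rewrite !cmapE; apply: eq_lin => x; rewrite -!gactM gmulA gmulgV gmul1g.
Qed.

Lemma supp_family : invariant_family supp.
Proof.
split=> //.
- exact: supp_inv.
- by move=> T H c c' e sc x nx; rewrite -e //; apply: sc.
- move=> T H c c' sc sc' x nx; rewrite coef_cat.
  case: (eqVneq (coef c x) 0) => [->|/eqP c0 _]; last exact: sc.
  by rewrite add0r; apply: sc'.
(* A nonzero coefficient at y must come from some x in the support of c with y in the support of g
   x. Then H fixes x, hence lies in the stabilizer of x, which fixes y. If a moves y, every term of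
   the sum therefore vanishes. *)
- move=> T U H g c [g0 _] sg sc y ny cy a Ha.
  case: (excluded_middle_informative (gact a y = y)) => // ay; case: cy.
  rewrite coef_lin; apply: (sum_eq0 (phi := fun x => coef (g x) y)) => x.
  case: (excluded_middle_informative (gnull x)) => nx.
    by rewrite g0 // coef_nil mulr0.
  case: (eqVneq (coef c x) 0) => [->|/eqP cx]; first by rewrite mul0r.
  case: (eqVneq (coef (g x) y) 0) => [->|/eqP gxy]; first by rewrite mulr0.
  by case: ay; apply: sg gxy _ _ => //; apply: sc.
- move=> T H H' a c sc HH x nx; rewrite coef_gact => cx b Hb.
  have nx' : ~ gnull (gact (ginv a) x) by move/(gnull_act a); rewrite gactVK.
  have := sc _ nx' cx _ (HH b Hb).
  by rewrite !gactM gactVK => /(congr1 (gact a)); rewrite !gactVK.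
Qed.

(** * Equivariant lifting *)

Section Lifting.
Variable D : forall T : gbasis, (G -> Prop) -> chain R T -> Prop.
Hypothesis famD : invariant_family D.

Lemma fam_nil T H : D H ([::] : chain R T).
Proof. by apply: fam_supp famD _ _ _ _ => x _; rewrite coef_nil. Qed.

Lemma fam_gen T r (x : T) : D (gstab x) [:: (x, r)].
Proof.
apply: fam_supp famD _ _ _ _ => y _; rewrite coef_cons coef_nil addr0 /=.
by case: ceqP => [<-|].
Qed.

(** Multiplication by r is the linear extension of the equivariant map sending x to r x, so
    [fam_lin] applies. *)
Lemma fam_scale T H r (c : chain R T) : D H c -> D H (cscale r c).
Proof.
move=> Dc; apply: (@fam_eqv _ famD _ _ (lin (fun x => [:: (x, r)]) c)).
  move=> y _; rewrite coef_lin coef_scale /coef mulr_sumr big_mkcond /=.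
  by rewrite [RHS]big_mkcond; apply: eq_bigr => p _; rewrite big_cons big_nil;
     case: ifP; rewrite ?addr0 ?mulr0 // mulrC.
apply: fam_lin famD _ _ _ _ _ _ _ Dc => [|x]; last exact: fam_gen.
by split=> [x|a x]; [apply: eqv_unit_null | apply: eqv_refl].
Qed.

(* Choose the lifts at orbit representatives and translate them: this is well
   defined up to [eqv] because D consists of invariant chains. *)
Lemma equivariant_lift T U V (d : U -> chain R V) (t : T -> chain R V) :
  equivar d -> equivar t ->
  (forall x, ~ gnull x -> exists u, D (gstab x) u /\ eqv (lin d u) (t x)) ->
  exists s : T -> chain R U,
    [/\ equivar s, (forall x, D (gstab x) (s x)) & forall x, eqv (lin d (s x)) (t x)].
Proof.
move=> ed et lift.
(* The hypothesis provides lifts at non-null elements only; taking the empty chain at the null ones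
   makes s kill them. *)
have /skolem[u uP] : forall x : T, exists u : chain R U,
    [/\ D (gstab x) u, eqv (lin d u) (t x) & gnull x -> u = [::]].
  move=> x; case: (excluded_middle_informative (gnull x)) => nx.
    by exists [::]; split=> //; [apply: fam_nil | apply: eqv_sym; apply: et.1].
  by have [u [Du ux]] := lift x nx; exists u.
have [rep [tr [trP repP]]] := orbit_repr T.
have trV x : gact (ginv (tr x)) x = rep x by rewrite -{2}(trP x) gactK.
exists (fun x => cmap (gact (tr x)) (u (rep x))); split; first split.
- move=> x nx; have [_ _ ->] := uP (rep x); first exact: eqv_refl.
  by rewrite -(gactK (tr x) (rep x)) trP; apply: gnull_act.
- move=> a x; rewrite repP cmap_cmap.
  (* Both [tr (gact a x)] and a followed after [tr x] carry the representative to the translate of x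
     by a. They differ by b, which stabilizes the representative and so preserves the lift chosen
     there. *)
  set b := gmul (ginv (tr x)) (gmul (ginv a) (tr (gact a x))).
  have bP : gstab (rep x) b.
    rewrite /gstab /b !gactM.
    by have := trP (gact a x); rewrite repP => ->; rewrite gactK trV.
  have [Du _ _] := uP (rep x).
  apply: eqv_trans (_ : eqv _ (cmap (fun y => gact a (gact (tr x) y))
    (cmap (gact b) (u (rep x))))) _.
    rewrite cmap_cmap !cmapE; apply: eq_lin => y.
    by rewrite /b !gactM !gactVK.
  rewrite -!(cmap_cmap (gact a) (gact (tr x))); do 2 apply: gact_eqv.
  exact: fam_inv famD _ _ _ Du _ bP.
- move=> x; have [Du _ _] := uP (rep x).
  apply: fam_act famD _ _ _ _ _ Du _ => b.
  by rewrite /gstab !gactM trP => ->; rewrite trV.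
- move=> x; have [_ ux _] := uP (rep x).
  apply: eqv_trans (lin_equivar _ _ ed) _.
  apply: eqv_trans (gact_eqv _ ux) _.
  by apply: eqv_sym; have := et.2 (tr x) (rep x); rewrite trP.
Qed.

End Lifting.
End GBases.

(** * Equivariant contractions *)

Section GComplexes.
Variables (G : grp) (R : comPzRingType).
Implicit Types (S T U V : gbasis G) (H : G -> Prop).

Lemma lin_catf T U (g h : T -> chain R U) c :
  eqv (lin (fun x => g x ++ h x) c) (lin g c ++ lin h c).
Proof.
move=> y _; rewrite coef_cat !coef_lin -big_split; apply: eq_bigr => p _.
by rewrite coef_cat mulrDr.
Qed.

Lemma lin_scalef T U r (g : T -> chain R U) c :
  eqv (lin (fun x => cscale r (g x)) c) (cscale r (lin g c)).
Proof.
move=> y _; rewrite coef_scale !coef_lin mulr_sumr; apply: eq_bigr => p _.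
by rewrite coef_scale mulrCA.
Qed.

Lemma lin_id T (c : chain R T) : lin (@unit_chain R T) c = c.
Proof. by elim: c => [|[x r] c IH] //; rewrite lin_cons IH /= mulr1. Qed.

Lemma lin_nilf T U (c : chain R T) : lin (fun _ => [::] : chain R U) c = [::].
Proof. by elim: c. Qed.

Lemma equivar_comp T U V (g : U -> chain R V) (h : T -> chain R U) :
  equivar g -> equivar h -> equivar (fun x => lin g (h x)).
Proof.
move=> eg eh; split=> [x nx|a x]; first exact: lin_eqv eg.1 (eh.1 x nx).
exact: eqv_trans (lin_eqv eg.1 (eh.2 a x)) (lin_equivar _ _ eg).
Qed.

Lemma equivar_cat T U (g h : T -> chain R U) :
  equivar g -> equivar h -> equivar (fun x => g x ++ h x).
Proof.
move=> eg eh; split=> [x nx|a x] y ny; rewrite ?cmap_cat !coef_cat.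
  by rewrite eg.1 ?eh.1 // coef_nil addr0.
by rewrite eg.2 ?eh.2.
Qed.

Lemma equivar_scale T U r (g : T -> chain R U) :
  equivar g -> equivar (fun x => cscale r (g x)).
Proof.
move=> eg; split=> [x nx|a x] y ny; rewrite ?cmap_scale !coef_scale.
  by rewrite eg.1 // coef_nil mulr0.
by rewrite eg.2.
Qed.

Definition gmap T U (j : T -> U) :=
  (forall x, gnull x -> gnull (j x)) /\ (forall a x, j (gact a x) = gact a (j x)).

Lemma equivar_gmap T U V (j : T -> U) (g : U -> chain R V) :
  gmap j -> equivar g -> equivar (fun x => g (j x)).
Proof.
move=> [j0 ja] [g0 ga]; split=> [x nx|a x]; first exact/g0/j0.
by rewrite ja; apply: ga.
Qed.

Lemma equivar_unit T : equivar (@unit_chain R T).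
Proof. by split=> [x nx|a x]; [apply: eqv_unit_null | apply: eqv_refl]. Qed.

(** Through [fam_supp], the field [cd_supp] puts the boundary of x into every invariant family for
    the stabilizer of x, as the inductive construction of a contraction requires. *)
Record gcomplex := GComplex {
  cb :> nat -> gbasis G;
  cd : forall n, cb n.+1 -> chain R (cb n);
  cd_equivar : forall n, equivar (@cd n);
  cd_supp : forall n (x : cb n.+1), supp (gstab x) (cd x);
  cd_cd : forall n (x : cb n.+2), eqv (lin (@cd n) (cd x)) [::] }.

Definition cycle (Z : gcomplex) n : chain R (Z n) -> Prop :=
  match n with
  | 0 => fun _ => True
  | m.+1 => fun c => eqv (lin (@cd Z m) c) [::]
  end.

Section Contraction.
Variable D : forall T : gbasis G, (G -> Prop) -> chain R T -> Prop.
Hypothesis famD : invariant_family D.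
Variable F : (G -> Prop) -> Prop.

Lemma fam_gmap T U H (j : T -> U) c : gmap j -> D H c -> D H (cmap j c).
Proof.
move=> gj Dc; rewrite cmapE; apply: fam_lin famD _ _ _ _ _ _ _ Dc.
  exact: equivar_gmap gj (equivar_unit U).
move=> x; apply: fam_supp famD _ _ _ _ => y _; rewrite coef_unit.
by case: ceqP => // <- _ a ax; rewrite -gj.2 ax.
Qed.

Definition acyclic (Z : gcomplex) := forall H, F H ->
  forall n (c : chain R (Z n)), D H c -> cycle c ->
  exists b, D H b /\ eqv (lin (@cd Z n) b) c.

(** Being a section of the differential on cycles is all that the next degree needs from s. *)
Definition partial_contraction (Z : gcomplex) n (s : Z n -> chain R (Z n.+1)) :=
  [/\ equivar s, (forall x, D (gstab x) (s x)) &
      forall c, cycle c -> eqv (lin (@cd Z n) (lin s c)) c].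

Section Steps.
Variable Z : gcomplex.
Hypothesis stabZ : forall n (x : Z n), F (gstab x).
Hypothesis acZ : acyclic Z.

(** Every chain of degree 0 is a cycle, so the identity itself lifts through the differential. *)
Lemma contraction0 : exists s, partial_contraction s /\
  forall x : Z 0%N, eqv (lin (@cd Z 0) (s x)) (unit_chain R x).
Proof.
have [|s [es Ds sP]] := equivariant_lift famD (@cd_equivar Z 0) (equivar_unit (Z 0%N)).
  by move=> x _; apply: acZ => //; apply: fam_gen famD _ _ _.
exists s; split=> //; split=> // c _.
rewrite lin_lin -{2}(lin_id c); exact: eq_lin.
Qed.

(** Since d x is a cycle, d s d x = d x, so x - s d x is a cycle; s' is an equivariant lift of it
    through d. On a cycle c the correction s d c vanishes, which leaves d s' c = c. *)
Lemma contractionS n (s : Z n -> chain R (Z n.+1)) : partial_contraction s ->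
  exists s', partial_contraction s' /\
  forall x, eqv (lin (@cd Z n.+1) (s' x) ++ lin s (cd x)) (unit_chain R x).
Proof.
move=> [es Ds sP].
pose t (x : Z n.+1) := unit_chain R x ++ cscale (-1) (lin s (cd x)).
have et : equivar t.
  apply: equivar_cat; first exact: equivar_unit.
  exact/equivar_scale/equivar_comp/cd_equivar.
have cyc_cd (x : Z n.+1) : cycle (cd x).
  by case: n x {s es Ds sP t et} => // n x; apply: cd_cd.
have [|s' [es' Ds' sP']] := equivariant_lift famD (@cd_equivar Z n.+1) et.
  move=> x _; apply: acZ => //.
    apply: fam_cat famD _ _ _ _ _ _; first exact: fam_gen famD _ _ _.
    apply: fam_scale famD _ _ _ _ _; apply: fam_lin famD _ _ _ _ _ es Ds _.
    apply: fam_supp famD _ _ _ _; exact: cd_supp.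
  move=> z nz; rewrite /= /t lin_cat lin_scale lin_unit coef_cat coef_scale sP //.
  by rewrite coef_nil; ring.
exists s'; split.
  split=> // c cc; rewrite lin_lin; apply: eqv_trans (eq_lin _ sP') _.
  apply: eqv_trans (lin_catf _ _ _) _; rewrite lin_id => z nz.
  rewrite coef_cat lin_scalef // coef_scale -lin_lin.
  by rewrite (lin_eqv es.1 cc) // coef_nil; ring.
move=> x z nz; rewrite coef_cat sP' // /t coef_cat coef_scale.
by ring.
Qed.

Lemma contraction : exists s : forall n, Z n -> chain R (Z n.+1),
  [/\ forall n, equivar (s n),
      forall x, eqv (lin (@cd Z 0) (s 0%N x)) (unit_chain R x) &
      forall n x, eqv (lin (@cd Z n.+1) (s n.+1 x) ++ lin (s n) (cd x)) (unit_chain R x)].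
Proof.
pose S n := {s : Z n -> chain R (Z n.+1) | partial_contraction s}.
have [s0 [ps0 s0P]] := contraction0.
(* The choice is made over pairs of a degree and a partial contraction in that degree, so that the
   recursion can feed each s n to it and keep the identity linking s n with its successor. *)
have /skolem[next nextP] : forall i : {n & S n}, exists s' : S (projT1 i).+1,
    forall x, eqv (lin (@cd Z _) (sval s' x) ++ lin (sval (projT2 i)) (cd x))
                  (unit_chain R x).
  by move=> [n [s ps]]; have [s' [ps' s'P]] := contractionS ps; exists (exist _ s' ps').
pose s := nat_rect S (exist _ s0 ps0) (fun n sn => next (existT S n sn)).
exists (fun n => sval (s n)); split=> // [n|n x]; first by case: (s n) => ? [].
exact: nextP (existT S n (s n)) x.
Qed.
End Steps.
End Contraction.
End GComplexes.

Local Arguments cmap : simpl never.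
Local Arguments unit_chain : simpl never.

(** * The mapping cone *)

Section Cone.
Variables (G : grp) (R : comPzRingType).

Definition gempty : gbasis G :=
  @GBasis G Empty_set (fun _ => False) (fun _ x => x) (fun _ => erefl)
    (fun _ _ _ => erefl) (fun _ _ => id).

Lemma equivar_cmap (T U V : gbasis G) (j : U -> V) (g : T -> chain R U) :
  gmap j -> equivar g -> equivar (fun x => cmap j (g x)).
Proof.
move=> gj eg.
have -> : (fun x => cmap j (g x)) = (fun x => lin (fun y => unit_chain R (j y)) (g x)).
  by apply: functional_extensionality => x; rewrite cmapE.
exact: equivar_comp (equivar_gmap gj (equivar_unit R V)) eg.
Qed.

Section Sum.
Variables S T : gbasis G.

Definition sum_null (e : S + T) : Prop :=
  match e with inl x => gnull x | inr y => gnull y end.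

Definition sum_act (a : G) (e : S + T) : S + T :=
  match e with inl x => inl (gact a x) | inr y => inr (gact a y) end.

Lemma sum_act1 e : sum_act (gone G) e = e.
Proof. by case: e => x /=; rewrite gact1. Qed.

Lemma sum_actM a b e : sum_act (gmul a b) e = sum_act a (sum_act b e).
Proof. by case: e => x /=; rewrite gactM. Qed.

Lemma sum_null_act a e : sum_null e -> sum_null (sum_act a e).
Proof. by case: e => x; apply: gnull_act. Qed.

Definition gsum : gbasis G := GBasis sum_act1 sum_actM sum_null_act.

Definition ginl (x : S) : gsum := inl x.
Definition ginr (y : T) : gsum := inr y.

Lemma gmap_inl : gmap ginl. Proof. by []. Qed.
Lemma gmap_inr : gmap ginr. Proof. by []. Qed.

(** An equality of predicates, because stabilizers occur as arguments of the arbitrary [D] and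
    [F]. *)
Lemma gstab_inl x : gstab (ginl x) = gstab x.
Proof.
apply: functional_extensionality => a; apply: propositional_extensionality.
by rewrite /gstab /=; split=> [[]|->].
Qed.

Lemma gstab_inr x : gstab (ginr x) = gstab x.
Proof.
apply: functional_extensionality => a; apply: propositional_extensionality.
by rewrite /gstab /=; split=> [[]|->].
Qed.

Definition projl (e : gsum) : chain R S := if e is inl x then unit_chain R x else [::].
Definition projr (e : gsum) : chain R T := if e is inr y then unit_chain R y else [::].

Lemma equivar_projl : equivar projl.
Proof.
by split=> [[x|y] //= nx|a [x|y]]; [apply: eqv_unit_null | apply: eqv_refl | apply: eqv_refl].
Qed.

Lemma equivar_projr : equivar projr.
Proof.
by split=> [[x|y] //= nx|a [x|y]]; [apply: eqv_unit_null | apply: eqv_refl | apply: eqv_refl].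
Qed.

Lemma coef_inl (c : chain R gsum) x : coef c (ginl x) = coef (lin projl c) x.
Proof.
elim: c => [|[e r] c IH]; first by rewrite !coef_nil.
rewrite lin_cons coef_cons coef_cat coef_scale IH; congr (_ + _).
case: e => y /=; last by rewrite coef_nil mulr0; case: ceqP.
by rewrite coef_unit; do 2 case: ceqP; rewrite ?mulr1 ?mulr0 //; [move=> ne [] | move=> -> []].
Qed.

Lemma coef_inr (c : chain R gsum) x : coef c (ginr x) = coef (lin projr c) x.
Proof.
elim: c => [|[e r] c IH]; first by rewrite !coef_nil.
rewrite lin_cons coef_cons coef_cat coef_scale IH; congr (_ + _).
case: e => y /=; first by rewrite coef_nil mulr0; case: ceqP.
by rewrite coef_unit; do 2 case: ceqP; rewrite ?mulr1 ?mulr0 //; [move=> ne [] | move=> -> []].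
Qed.

Lemma eqv_sum (c c' : chain R gsum) :
  eqv (lin projl c) (lin projl c') -> eqv (lin projr c) (lin projr c') -> eqv c c'.
Proof. by move=> el er [x|y] nx; rewrite ?coef_inl ?coef_inr; [apply: el | apply: er]. Qed.

Lemma eqv_projl (c c' : chain R gsum) : eqv c c' -> eqv (lin projl c) (lin projl c').
Proof. exact: lin_eqv equivar_projl.1. Qed.

Lemma eqv_projr (c c' : chain R gsum) : eqv c c' -> eqv (lin projr c) (lin projr c').
Proof. exact: lin_eqv equivar_projr.1. Qed.

Lemma projl_inl c : lin projl (cmap ginl c) = c.
Proof. by rewrite lin_cmap lin_id. Qed.

Lemma projl_inr c : lin projl (cmap ginr c) = [::].
Proof. by rewrite lin_cmap lin_nilf. Qed.

Lemma projr_inr c : lin projr (cmap ginr c) = c.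
Proof. by rewrite lin_cmap lin_id. Qed.

Lemma projr_inl c : lin projr (cmap ginl c) = [::].
Proof. by rewrite lin_cmap lin_nilf. Qed.

Lemma equivar_sum (U : gbasis G) (g : gsum -> chain R U) :
  equivar (fun x => g (ginl x)) -> equivar (fun y => g (ginr y)) -> equivar g.
Proof.
move=> el er; split=> [[x|y]|a [x|y]]; [exact: el.1|exact: er.1|exact: el.2|exact: er.2].
Qed.

End Sum.
Arguments ginl {S T} x.
Arguments ginr {S T} y.
Arguments projl {S T} e.
Arguments projr {S T} e.

Definition proj_inE := (projl_inl, projl_inr, projr_inl, projr_inr).

(* The shift by one keeps the mapping cone of f : X -> Y in nonnegative
   degrees: its n-th basis is X_(n-1) + Y_n, with X_(-1) empty. *)
Definition shift (X : gcomplex G R) n : gbasis G := if n is m.+1 then X m else gempty.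

Definition shift_d (X : gcomplex G R) n : shift X n.+1 -> chain R (shift X n) :=
  match n with 0 => fun _ => [::] | m.+1 => @cd _ _ X m end.

Lemma equivar_shift_d X n : equivar (@shift_d X n).
Proof. by case: n => [|n]; [split | apply: cd_equivar]. Qed.

Lemma supp_shift_d X n (x : shift X n.+1) : supp (gstab x) (shift_d x).
Proof. by case: n x => [|n] x; [move=> [] | apply: cd_supp]. Qed.

Lemma shift_dd X n (x : shift X n.+2) : eqv (lin (@shift_d X n) (shift_d x)) [::].
Proof. by case: n x => [|n] x; [move=> [] | apply: cd_cd]. Qed.

Lemma shift_cycle (X : gcomplex G R) n (c : chain R (X n)) :
  eqv (lin (@shift_d X n) c) [::] -> cycle c.
Proof. by case: n c. Qed.

Variables X Y : gcomplex G R.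
Variable phi : forall n, X n -> Y n.
Hypothesis gmap_phi : forall n, gmap (@phi n).
Hypothesis phi_cd : forall n (x : X n.+1), eqv (cd (phi x)) (cmap (@phi n) (cd x)).

Definition cone_basis n := gsum (shift X n) (Y n).

(** The differential (x, y) to (- d x, phi x + d y); the sign makes the two copies of phi d x in its
    square cancel. *)
Definition cone_d n (e : cone_basis n.+1) : chain R (cone_basis n) :=
  match e with
  | inl x => cscale (-1) (cmap ginl (shift_d x)) ++ cmap ginr (unit_chain R (@phi n x))
  | inr y => cmap ginr (cd y)
  end.

Lemma projl_cone_inl n (x : shift X n.+1) :
  lin projl (cone_d (ginl x : cone_basis n.+1)) = cscale (-1) (shift_d x).
Proof. by rewrite /= lin_cat (lin_scale projl) !proj_inE cats0. Qed.

Lemma projr_cone_inl n (x : shift X n.+1) :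
  lin projr (cone_d (ginl x : cone_basis n.+1)) = unit_chain R (@phi n x).
Proof. by rewrite /= lin_cat (lin_scale projr) !proj_inE. Qed.

Lemma projl_cone_d n (c : chain R (cone_basis n.+1)) :
  eqv (lin projl (lin (@cone_d n) c)) (cscale (-1) (lin (@shift_d X n) (lin projl c))).
Proof.
rewrite !lin_lin; apply: eqv_trans
  (_ : eqv _ (lin (fun e => cscale (-1) (lin (@shift_d X n) (projl e))) c)) _.
  apply: eq_lin => -[x|y] /=; rewrite ?lin_cat ?lin_scale ?proj_inE //.
  by rewrite cats0 lin_unit.
exact: lin_scalef.
Qed.

Lemma projr_cone_d n (c : chain R (cone_basis n.+1)) :
  eqv (lin projr (lin (@cone_d n) c))
      (cmap (@phi n) (lin projl c) ++ lin (@cd _ _ Y n) (lin projr c)).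
Proof.
rewrite !lin_lin cmap_lin; apply: eqv_trans (_ : eqv _ (lin (fun e : cone_basis n.+1 =>
    cmap (@phi n) (projl e) ++ lin (@cd _ _ Y n) (projr e)) c)) _.
  apply: eq_lin => -[x|y] /=; rewrite ?lin_cat ?lin_scale ?proj_inE ?lin_unit //.
exact: lin_catf.
Qed.

Lemma equivar_cone_d n : equivar (@cone_d n).
Proof.
apply: equivar_sum; last exact: (equivar_cmap (@gmap_inr _ _) (@cd_equivar _ _ Y n)).
apply: (equivar_cat (g := fun x => cscale (-1) (cmap ginl (shift_d x)))
                    (h := fun x => cmap ginr (unit_chain R (@phi n x)))).
  exact/equivar_scale/equivar_cmap/equivar_shift_d.
apply: (equivar_cmap (g := fun x => unit_chain R (@phi n x))) => //.
exact/equivar_gmap/equivar_unit.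
Qed.

Lemma supp_cone_d n (e : cone_basis n.+1) : supp (gstab e) (cone_d e).
Proof.
have fs := supp_family G R.
case: e => [x|y]; rewrite ?gstab_inl ?gstab_inr /=; last first.
  by apply: (fam_gmap fs) => //; apply: cd_supp.
apply: (fam_cat fs).
  by apply: (fam_scale fs); apply: (fam_gmap fs) => //; apply: supp_shift_d.
move=> y _; rewrite cmapE lin_unit coef_unit; case: ceqP => // <- _ a ax.
by congr inr; rewrite -[in RHS]ax (gmap_phi n).2.
Qed.

Lemma cone_dd n (e : cone_basis n.+2) : eqv (lin (@cone_d n) (cone_d e)) [::].
Proof.
apply: eqv_sum.
  apply: eqv_trans (projl_cone_d _) _; case: e => [x|y] z nz; last first.
    by rewrite proj_inE coef_nil.
  by rewrite projl_cone_inl lin_scale !coef_scale (shift_dd x nz) coef_nil !mulr0.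
apply: eqv_trans (projr_cone_d _) _; case: e => [x|y] z nz; last by rewrite !proj_inE cd_cd.
rewrite projl_cone_inl projr_cone_inl lin_unit.
by rewrite cmap_scale coef_cat coef_scale (phi_cd x nz) coef_nil /=; ring.
Qed.

Lemma lin_cone_inl U n (k : cone_basis n -> chain R U) (x : shift X n.+1) :
  lin k (cone_d (ginl x : cone_basis n.+1)) =
  cscale (-1) (lin (fun x' => k (ginl x')) (shift_d x)) ++ k (ginr (@phi n x)).
Proof. by rewrite /= lin_cat (lin_scale k) !(lin_cmap k) lin_unit. Qed.

Lemma lin_cone_inr U n (k : cone_basis n -> chain R U) (y : Y n.+1) :
  lin k (cone_d (ginr y : cone_basis n.+1)) = lin (fun y' => k (ginr y')) (cd y).
Proof. by rewrite (lin_cmap k). Qed.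

Definition cone : gcomplex G R := GComplex equivar_cone_d supp_cone_d cone_dd.

(** * Acyclicity of the cone and the resulting homotopy equivalence *)

Section ConeAcyclic.
Variable D : forall T : gbasis G, (G -> Prop) -> chain R T -> Prop.
Hypothesis famD : invariant_family D.
Variable F : (G -> Prop) -> Prop.
Hypothesis phi_quasi : forall H, F H ->
  (forall n (b : chain R (Y n)), D H b -> cycle b ->
     exists a : chain R (X n), [/\ D H a, cycle a &
       exists b', D H b' /\ eqv (cmap (@phi n) a) (b ++ lin (@cd _ _ Y n) b')]) /\
  (forall n (a : chain R (X n)), D H a -> cycle a ->
     (exists b', D H b' /\ eqv (cmap (@phi n) a) (lin (@cd _ _ Y n) b')) ->
     exists a', D H a' /\ eqv a (lin (@cd _ _ X n) a')).

Lemma fam_proj S T H (c : chain R (gsum S T)) :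
  D H c -> D H (lin projl c) /\ D H (lin projr c).
Proof.
move=> Dc; split; apply: fam_lin famD _ _ _ _ _ _ _ Dc.
- exact: equivar_projl.
- by case=> [x|y]; [rewrite gstab_inl; apply: fam_gen famD _ _ _ | apply: fam_nil famD _ _].
- exact: equivar_projr.
- by case=> [x|y]; [apply: fam_nil famD _ _ | rewrite gstab_inr; apply: fam_gen famD _ _ _].
Qed.

Lemma cmap_cd n (c : chain R (X n.+1)) :
  eqv (lin (@cd _ _ Y n) (cmap (@phi n.+1) c)) (cmap (@phi n) (lin (@cd _ _ X n) c)).
Proof. by rewrite lin_cmap cmap_lin; apply: eq_lin => x; apply: phi_cd. Qed.

Lemma cmap_eqv n (c c' : chain R (X n)) :
  eqv c c' -> eqv (cmap (@phi n) c) (cmap (@phi n) c').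
Proof.
rewrite !cmapE; apply: lin_eqv => x nx.
exact/eqv_unit_null/(gmap_phi n).1.
Qed.

(** A cycle (a, b) satisfies d a = 0 and phi a = d (- b). Injectivity on homology gives a = d a';
    then b + phi a' is a cycle, and surjectivity gives phi a'' = b + phi a' + d b' with a'' a cycle.
    All choices stay in D. *)
Lemma cone_acyclic : acyclic D F cone.
Proof.
move=> H /phi_quasi[surj inj] [|n] c Dc cyc; have [Da Db] := fam_proj Dc.
  (* In degree 0 the cone is Y_0 alone and every chain is a cycle: if phi a = b + d b', then (a, -
     b') has boundary b. *)
  have [a [Da' _ [b' [Db' e]]]] := surj 0%N _ Db I.
  exists (cmap ginl a ++ cmap ginr (cscale (-1) b')); split.
    apply: fam_cat famD _ _ _ _ _ _; apply: (fam_gmap famD) => //.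
    exact: fam_scale famD _ _ _ _ _.
  apply: eqv_sum; first by case.
  apply: eqv_trans (projr_cone_d _) _ => z nz.
  rewrite !lin_cat !proj_inE cats0 lin_scale coef_cat coef_scale e // coef_cat.
  by rewrite -/(lin _ c); ring.
set a := lin projl c in Da; set b := lin projr c in Db.
have cyca : eqv (lin (@shift_d X n) a) [::].
  move=> z nz; have := projl_cone_d c nz; rewrite (eqv_projl cyc) // coef_scale.
  by rewrite !coef_nil mulN1r => /esym/eqP; rewrite oppr_eq0 => /eqP.
have cycb : eqv (cmap (@phi n) a ++ lin (@cd _ _ Y n) b) [::].
  exact: eqv_trans (eqv_sym (projr_cone_d c)) (eqv_projr cyc).
have [|a' [Da' ea']] := inj n a Da (shift_cycle cyca).
  exists (cscale (-1) b); split; first exact: fam_scale famD _ _ _ _ _.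
  move=> z nz; have := cycb z nz; rewrite coef_cat coef_nil lin_scale coef_scale mulN1r.
  by move/eqP; rewrite addr_eq0 => /eqP.
have [||a'' [Da'' cyca'' [b' [Db' e]]]] := surj n.+1 (b ++ cmap (@phi n.+1) a').
- by apply: fam_cat famD _ _ _ _ _ _ => //; apply: (fam_gmap famD).
- move=> z nz; rewrite -(cycb z nz) lin_cat !coef_cat cmap_cd //.
  by rewrite -(cmap_eqv ea') // addrC.
(* The boundary of (a'' - a', - b') is (d a' - d a'', phi a'' - phi a' - d b') = (a, b). *)
exists (cmap ginl (a'' ++ cscale (-1) a') ++ cmap ginr (cscale (-1) b')); split.
  apply: fam_cat famD _ _ _ _ _ _; apply: (fam_gmap famD) => //.
    apply: fam_cat famD _ _ _ _ _ _ => //.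
    exact: fam_scale famD _ _ _ _ _.
  exact: fam_scale famD _ _ _ _ _.
apply: eqv_sum.
  apply: eqv_trans (projl_cone_d _) _ => z nz.
  rewrite lin_cat !proj_inE cats0 lin_cat lin_scale coef_scale coef_cat coef_scale /=.
  by rewrite cyca'' // -(ea' z) // coef_nil; ring.
apply: eqv_trans (projr_cone_d _) _ => z nz.
rewrite lin_cat !proj_inE cats0 lin_cat !proj_inE lin_scale cmap_cat cmap_scale.
by rewrite !coef_cat !coef_scale e // !coef_cat; ring.
Qed.

Lemma cone_equivalence :
  (forall n (x : X n), F (gstab x)) -> (forall n (y : Y n), F (gstab y)) ->
  exists (g : forall n, Y n -> chain R (X n)) (hX : forall n, X n -> chain R (X n.+1))
         (hY : forall n, Y n -> chain R (Y n.+1)),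
    [/\ forall n, equivar (g n), forall n, equivar (hX n), forall n, equivar (hY n),
        forall n (y : Y n.+1), eqv (lin (@cd _ _ X n) (g n.+1 y)) (lin (g n) (cd y)) &
        [/\ forall x, eqv (g 0 (@phi 0 x) ++ [:: (x, -1)]) (lin (@cd _ _ X 0) (hX 0 x)),
            forall n x, eqv (g n.+1 (@phi n.+1 x) ++ [:: (x, -1)])
              (lin (@cd _ _ X n.+1) (hX n.+1 x) ++ lin (hX n) (cd x)),
            forall y, eqv (cmap (@phi 0) (g 0 y) ++ [:: (y, -1)])
              (lin (@cd _ _ Y 0) (hY 0 y)) &
            forall n y, eqv (cmap (@phi n.+1) (g n.+1 y) ++ [:: (y, -1)])
              (lin (@cd _ _ Y n.+1) (hY n.+1 y) ++ lin (hY n) (cd y))]].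
Proof.
move=> stX stY.
have [|s [es s0 sS]] := contraction famD _ cone_acyclic.
  move=> n [x|y]; last by rewrite gstab_inr; apply: stY.
  by case: n x => [[]|n x]; rewrite gstab_inl; apply: stX.
have sSl n e : eqv (cscale (-1) (lin (@shift_d X n.+1) (lin projl (s n.+1 e))) ++
    lin (fun e' => lin projl (s n e')) (cone_d e)) (projl e).
  move=> z nz; have := eqv_projl (sS n e) nz.
  by rewrite lin_cat lin_unit (lin_lin _ (s n)) !coef_cat projl_cone_d.
have sSr n e : eqv (cmap (@phi n.+1) (lin projl (s n.+1 e)) ++
    lin (@cd _ _ Y n.+1) (lin projr (s n.+1 e)) ++
    lin (fun e' => lin projr (s n e')) (cone_d e)) (projr e).
  move=> z nz; have := eqv_projr (sS n e) nz.
  by rewrite lin_cat lin_unit (lin_lin _ (s n)) !coef_cat projr_cone_d // coef_cat addrA.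
have es_inl n : equivar (fun x : X n => s n.+1 (ginl x)).
  exact: equivar_gmap (@gmap_inl _ _) (es n.+1).
have es_inr n : equivar (fun y : Y n => s n (ginr y)).
  exact: equivar_gmap (@gmap_inr _ _) (es n).
(* Write s (0, y) = (g y, k y) and let hX x be the X-component of s (x, 0). The identity d s + s d =
   1 at (0, y) reads d g = g d and phi g + d k + k d = 1, and its X-component at (x, 0) reads g phi
   - 1 = d hX + hX d. Hence the homotopy on Y is - k. *)
exists (fun n y => lin projl (s n (ginr y))).
exists (fun n x => lin projl (s n.+1 (ginl x))).
exists (fun n y => cscale (-1) (lin projr (s n (ginr y)))).
split.
- by move=> n; apply: equivar_comp (equivar_projl _ _) (es_inr n).
- by move=> n; apply: equivar_comp (equivar_projl _ _) (es_inl n).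
- by move=> n; apply/equivar_scale/(equivar_comp (equivar_projr _ _) (es_inr n)).
- move=> n y z nz; have := sSl n (ginr y) z nz.
  rewrite lin_cone_inr coef_cat coef_scale coef_nil mulN1r => /eqP.
  by rewrite addrC subr_eq0 => /eqP <-.
split.
(* A vertex of X sits in degree 1 of the cone, where [shift_d] is zero, so no term hX d appears. *)
- move=> x z nz; have := sSl 0%N (ginl x) z nz.
  rewrite (lin_cone_inl (fun e => lin projl (s 0%N e))).
  rewrite unit_chainN !(coef_cat, coef_scale) /= lin_nil coef_nil => <-.
  by ring.
- move=> n x z nz; have := sSl n.+1 (ginl x) z nz.
  rewrite (lin_cone_inl (fun e => lin projl (s n.+1 e))).
  rewrite unit_chainN !(coef_cat, coef_scale) /= => <-.
  by ring.
- move=> y z nz; have := eqv_projr (s0 (ginr y)) nz.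
  rewrite projr_cone_d // lin_unit -[projr _]/(unit_chain R y) => e.
  by rewrite unit_chainN coef_cat coef_scale -e coef_cat lin_scale coef_scale; ring.
- move=> n y z nz; have := sSr n (ginr y) z nz.
  rewrite lin_cone_inr -[projr (ginr y)]/(unit_chain R y) => e.
  rewrite unit_chainN coef_cat coef_scale -e [RHS]coef_cat lin_scalef //.
  by rewrite lin_scale !coef_scale 2!coef_cat; ring.
Qed.
End ConeAcyclic.

End Cone.

(** * Normalized chains of simplicial G-sets *)

Section Simplicial.
Variables (G : grp) (R : comPzRingType).

Section SimplexBasis.
Variable X : sGset G.

Lemma degenerate_act n a (x : sim X n) : degenerate x -> degenerate (sact X n a x).
Proof.
case: n x => // n x [j [y [jn ->]]]; exists j, (sact X n a y).
by rewrite sact_degen.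
Qed.

Definition simplex_basis n : gbasis G :=
  GBasis (gnull := @degenerate X n) (sact1 G X n) (sactM G X n) (@degenerate_act n).

Definition simplex_bd n (x : simplex_basis n.+1) : chain R (simplex_basis n) :=
  [seq (face i x, (-1) ^+ i) | i <- iota 0 n.+2].

Lemma coef_simplex_bd n (x : simplex_basis n.+1) z :
  coef (simplex_bd x) z = \sum_(0 <= i < n.+2) (-1) ^+ i * (ceq (face i x) z)%:R.
Proof.
rewrite /coef big_map big_mkcond; apply: eq_bigr => i _ /=.
by case: ifP; rewrite ?mulr1 ?mulr0.
Qed.

(** For x = s_j y the faces of index j and j + 1 both equal y and carry opposite signs. All other
    faces are degenerate, so they contribute nothing at the non-degenerate z. *)
Lemma simplex_bd_degenerate n (x : simplex_basis n.+1) :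
  degenerate x -> eqv (simplex_bd x) [::].
Proof.
have [_ dsE dsL dsR _] := sGset_simplicial G X.
move=> [j [y [jn ->]]] z nz; rewrite coef_nil coef_simplex_bd.
rewrite (big_cat_nat (leq0n j) (leqW (leqW jn))).
rewrite (big_cat_nat (leqW (leqnSn j)) (jn : j.+2 <= n.+2)%N) /=.
rewrite big_nat_cond big1 ?add0r => [|i /andP[/andP[_ ij] _]].
  rewrite [X in _ + X]big_nat_cond [X in _ + X]big1 ?addr0 => [|i /andP[/andP[ji iz] _]].
    rewrite big_nat_recl // big_nat1 !dsE ?eqxx ?orbT // exprS.
    by rewrite -mulrDl mulN1r subrr mul0r.
  case: ceqP => [e|_]; last by rewrite mulr0.
  (* For n = 0 there are no faces besides the two that cancel; in higher degrees [dsR] exhibits the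
     face as degenerate. *)
  case: nz; case: n x jn y z iz e => [|n] x jn y z iz e.
    by move: (leq_trans ji iz).
  exists j, (face i.-1 y); split; last by rewrite -e dsR.
  exact: leq_ltn_trans ji iz.
case: ceqP => [e|_]; last by rewrite mulr0.
case: nz; case: n x jn y z e => [|n] x jn y z e; first by move: (leq_trans ij jn).
exists j.-1, (face i y); split; last by rewrite -e dsL.
by rewrite -ltnS prednK // (leq_ltn_trans _ ij).
Qed.

Lemma simplex_bd_equivar n : equivar (@simplex_bd n).
Proof.
split=> [|a x]; first exact: simplex_bd_degenerate.
suff -> : simplex_bd (gact a x) = cmap (gact a) (simplex_bd x) by [].
rewrite /cmap -map_comp; apply/eq_in_map => i; rewrite mem_iota /= => ilt.
by rewrite sact_face.
Qed.

(** An element of G stabilizing x stabilizes each face of x. *)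
Lemma simplex_bd_supp n (x : simplex_basis n.+1) : supp (gstab x) (simplex_bd x).
Proof.
move=> z nz; rewrite /coef big_map => c0 a ax.
case: (boolP (has (fun i => ceq (face i x) z) (iota 0 n.+2))) => [|h]; last first.
  by case: c0; rewrite big_hasC.
case/hasP => i; rewrite mem_iota /= => ilt /ceqP <-.
by rewrite /= sact_face // -[in RHS]ax.
Qed.

(** The term at (i, j) with i < j cancels the one at (j - 1, i): the values of F agree and the signs
    are opposite. *)
Lemma alternating_sum_eq0 n (F : nat -> nat -> R) :
  (forall i j, (i < j)%N -> (j <= n.+2)%N -> F i j = F j.-1 i) ->
  \sum_(0 <= j < n.+3) (-1) ^+ j * \sum_(0 <= i < n.+2) (-1) ^+ i * F i j = 0.
Proof.
move=> FE; pose T i j : R := (-1) ^+ j * ((-1) ^+ i * F i j).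
transitivity (\sum_(j < n.+3) \sum_(i < n.+2 | (i < j)%N) T i j +
              \sum_(j < n.+3) \sum_(i < n.+2 | ~~ (i < j)%N) T i j).
  rewrite big_mkord -big_split; apply: eq_bigr => j _.
  by rewrite big_mkord mulr_sumr (bigID (fun i : 'I__ => (i < j)%N)).
(* The row j = 0 of the first sum and the row j = n + 2 of the second are empty. Without them both
   sums run over the same square, and exchanging the order in the first aligns the cancelling
   terms. *)
rewrite big_ord_recl [X in X + _ + _]big_pred0 // add0r.
rewrite [X in _ + X]big_ord_recr [X in _ + (_ + X)]big_pred0 /=; last first.
  by move=> i; rewrite ltn_ord.
under eq_bigr => j _ do rewrite big_mkcond.
rewrite exchange_big addr0 -big_split big1 //= => i _.
rewrite [X in _ + X]big_mkcond -big_split big1 //= => j _.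
rewrite /bump leq0n add1n ltnS -leqNgt; case: ifP => [ij|_]; last exact: addr0.
by rewrite /T FE //= exprS; ring.
Qed.

Lemma simplex_bd_bd n (x : simplex_basis n.+2) :
  eqv (lin (@simplex_bd n) (simplex_bd x)) [::].
Proof.
have [dd _ _ _ _] := sGset_simplicial G X.
move=> z nz; rewrite coef_nil coef_lin big_map.
under eq_bigr => j _ do rewrite coef_simplex_bd /=.
apply: (@alternating_sum_eq0 n (fun i j => (ceq (face i (face j x)) z)%:R)) => i j ij jn.
by rewrite dd.
Qed.

Definition simplex_complex : gcomplex G R :=
  GComplex simplex_bd_equivar simplex_bd_supp simplex_bd_bd.

End SimplexBasis.

Variables X Y : sGset G.
Variable f : sGmap X Y.

Lemma gmap_smap n : @gmap G (simplex_basis X n) (simplex_basis Y n) (f n).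
Proof.
split=> [|a x]; last exact: smap_equiv.
case: n => // n x [j [y [jn ->]]]; exists j, (f n y).
by rewrite smap_degen.
Qed.

Lemma simplex_bd_smap n (x : simplex_basis X n.+1) :
  eqv (simplex_bd (f n.+1 x : simplex_basis Y n.+1)) (cmap (f n) (simplex_bd x)).
Proof.
suff -> : simplex_bd (f n.+1 x : simplex_basis Y n.+1) = cmap (f n) (simplex_bd x) by [].
rewrite /cmap -map_comp; apply/eq_in_map => i; rewrite mem_iota /= => ilt.
by rewrite smap_face.
Qed.

Lemma equivalence_of_family
    (D : forall T : gbasis G, (G -> Prop) -> chain R T -> Prop)
    (F : (G -> Prop) -> Prop) :
  invariant_family D ->
  (forall n (x : sim X n), F (stab x)) -> (forall n (y : sim Y n), F (stab y)) ->
  (forall H, F H -> @quasi_iso_sub R X Y (fun n => @D (simplex_basis X n) H)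
     (fun n => @D (simplex_basis Y n) H) (@Cmap R X Y f)) ->
  @equiv_htpy_equivalence R G X Y f.
Proof.
move=> famD stX stY quasi.
have [|g [hX [hY [eg ehX ehY gd [hX0 hXS hY0 hYS]]]]] :=
  @cone_equivalence G R (simplex_complex X) (simplex_complex Y) f gmap_smap
    simplex_bd_smap D famD F _ stX stY.
  move=> H /quasi[surj inj]; split=> [n b Db cb|n a Da ca].
    (* [cycle] and [scycle] agree by computation once the degree is split into zero and
       successor. *)
    by apply: surj => //; case: n b cb {Db}.
  by apply: inj => //; case: n a ca {Da}.
exists g, hX, hY; split.
- by split=> [n|n]; [exact: (eg n).1 | exact: (eg n).2].
- by move=> n y; rewrite /bd lin_unit; apply: gd.
- by split=> [n|n]; [exact: (ehX n).1 | exact: (ehX n).2].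
- by split=> [n|n]; [exact: (ehY n).1 | exact: (ehY n).2].
- split; split=> // n x; rewrite /(bd (unit_chain _ _)) lin_unit.
    exact: hXS.
  exact: hYS.
Qed.

End Simplicial.

(** * Chains of fixed-point sets as chains with fixed support *)

Section FixedSimplices.
Variables (G : grp) (R : comPzRingType) (H : G -> Prop).

Section FixedChains.
Variable X : sGset G.

Notation val := (@proj1_sig _ (@fixed G X H _)).

Lemma fixed_inj n (x y : sim (fixX X H) n) : val x = val y -> x = y.
Proof.
case: x y => [x fx] [y fy] /= xy; case: y / xy fy => fy.
by congr exist; apply: Classical_Prop.proof_irrelevance.
Qed.

Lemma fidxE n i : (i <= n)%N -> fidx n i = i.
Proof. by rewrite /fidx => ->. Qed.

(** If s_j y is fixed by H, then so is its face y = d_j s_j y; thus a fixed simplex degenerate in X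
    is already degenerate in the fixed-point set. *)
Lemma degenerate_fixed n (x : sim (fixX X H) n) : degenerate x <-> degenerate (val x).
Proof.
have [_ dsE _ _ _] := sGset_simplicial G X.
case: n x => [|n] x; first by [].
split=> -[j [y [jn xE]]].
  by exists j, (val y); rewrite xE /= fidxE.
have fy : fixed H y.
  rewrite -(dsE n j j y jn) ?eqxx // -xE => a Ha.
  by rewrite sact_face ?(leqW jn) // (proj2_sig x).
exists j, (exist _ y fy); split=> //.
by apply: fixed_inj; rewrite /= fidxE.
Qed.

Lemma coef_fixed n (c : chain R (sim (fixX X H) n)) x :
  coef (cmap val c) (val x) = coef c x.
Proof.
elim: c => [|[y r] c IH]; first by rewrite !coef_nil.
rewrite /= !coef_cons IH /=; congr (_ + _).
case: (ceqP y x) => [->|ne]; first by case: ceqP.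
by case: ceqP => // /fixed_inj.
Qed.

Lemma coef_not_fixed n (c : chain R (sim (fixX X H) n)) x :
  ~ fixed H x -> coef (cmap val c) x = 0.
Proof.
move=> nf; elim: c => [|[y r] c IH]; first by rewrite coef_nil.
rewrite coef_cons IH addr0; case: ceqP => //= yx.
by case: nf; rewrite -yx; apply: proj2_sig.
Qed.

Lemma ceqv_fixed n (c c' : chain R (sim (fixX X H) n)) :
  ceqv c c' <-> ceqv (cmap val c) (cmap val c').
Proof.
split=> e x nx.
  case: (excluded_middle_informative (fixed H x)) => fx; last by rewrite !coef_not_fixed.
  rewrite -[x]/(val (exist _ x fx)) !coef_fixed; apply: e.
  by move/degenerate_fixed.
by rewrite -!coef_fixed; apply: e => /degenerate_fixed.
Qed.

Lemma bd_fixed n (c : chain R (sim (fixX X H) n.+1)) :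
  bd (cmap val c) = cmap val (bd c).
Proof.
rewrite /bd lin_cmap cmap_lin; congr (lin _ c).
apply: functional_extensionality => x; rewrite /cmap -map_comp.
by apply/eq_in_map => i; rewrite mem_iota /= => ilt; rewrite fidxE.
Qed.

Definition restrict n (c : chain R (sim X n)) : chain R (sim (fixX X H) n) :=
  pmap (fun p => if excluded_middle_informative (fixed H p.1) is left fx
                 then Some (exist _ p.1 fx, p.2) else None) c.

Definition fixed_supp n (c : chain R (sim X n)) := @supp G R (simplex_basis X n) H c.

Lemma coef_restrict n (c : chain R (sim X n)) x : coef (restrict c) x = coef c (val x).
Proof.
elim: c => [|[y r] c IH]; first by rewrite !coef_nil.
rewrite /restrict /=; case: excluded_middle_informative => fy /=;
  rewrite !coef_cons -/(restrict c) IH /=.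
  congr (_ + _); case: (ceqP _ x) => [<-|ne]; first by case: ceqP.
  by case: ceqP => // yx; case: ne; apply: fixed_inj.
case: ceqP => [yx|_]; last by rewrite add0r.
by case: fy; rewrite yx; apply: proj2_sig.
Qed.

Lemma restrictK n (c : chain R (sim X n)) :
  fixed_supp c -> ceqv (cmap val (restrict c)) c.
Proof.
move=> sc x nx; case: (excluded_middle_informative (fixed H x)) => fx.
  by rewrite -[x]/(val (exist _ x fx)) coef_fixed coef_restrict.
rewrite coef_not_fixed //; case: (eqVneq (coef c x) 0) => [->//|/eqP cx].
by case: fx => a Ha; apply: sc cx _ Ha.
Qed.

Lemma supp_fixed n (c : chain R (sim (fixX X H) n)) : fixed_supp (cmap val c).
Proof.
move=> x nx cx a Ha; case: (excluded_middle_informative (fixed H x)) => fx.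
  exact: fx.
by case: cx; apply: coef_not_fixed.
Qed.

Lemma bd_ceqv n (c c' : chain R (sim X n.+1)) : ceqv c c' -> ceqv (bd c) (bd c').
Proof. exact: lin_eqv (simplex_bd_equivar R X n).1. Qed.

Lemma scycle_fixed n (c : chain R (sim (fixX X H) n)) :
  scycle (cmap val c) <-> scycle c.
Proof.
by case: n c => [//|n] c; split=> cc; [apply/ceqv_fixed; rewrite -bd_fixed |
  rewrite /= bd_fixed; apply/(ceqv_fixed _ [::])].
Qed.

Lemma scycle_ceqv n (c c' : chain R (sim X n)) : ceqv c c' -> scycle c -> scycle c'.
Proof.
case: n c c' => [//|n] c c' e cc x nx.
by rewrite -(bd_ceqv e nx) cc.
Qed.

End FixedChains.

Variables X Y : sGset G.
Variable f : sGmap X Y.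

Lemma Cmap_fixed n (c : chain R (sim (fixX X H) n)) :
  Cmap f (cmap (@proj1_sig _ _) c) = cmap (@proj1_sig _ _) (Cmap (@fixmap _ _ _ f H) c).
Proof. by rewrite /Cmap !cmap_cmap. Qed.

Lemma Cmap_ceqv n (c c' : chain R (sim X n)) :
  ceqv c c' -> ceqv (Cmap f c) (Cmap f c').
Proof.
exact: (cmap_eqv (X := simplex_complex R X) (Y := simplex_complex R Y) (gmap_smap f)).
Qed.

(** Up to [ceqv], the inclusion of fixed simplices and [restrict] are mutually inverse between
    chains of the fixed-point set and chains of X with fixed support. They respect boundaries and f,
    so both halves of the quasi-isomorphism condition carry over. *)
Lemma quasi_iso_fixed :
  @quasi_iso R (fixX X H) (fixX Y H) (@Cmap R _ _ (@fixmap G X Y f H)) ->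
  @quasi_iso_sub R X Y (@fixed_supp X) (@fixed_supp Y) (@Cmap R X Y f).
Proof.
move=> [surj inj]; split=> [n b sb cb|n a sa ca [b' [sb' e]]].
  have /(surj n _ I)[a [_ ca [b' [_ e]]]] : scycle (restrict b).
    by apply/scycle_fixed; apply: scycle_ceqv cb => x nx; rewrite restrictK.
  exists (cmap (@proj1_sig _ _) a); split.
  - exact: supp_fixed.
  - exact/scycle_fixed.
  exists (cmap (@proj1_sig _ _) b'); split; first exact: supp_fixed.
  move=> y ny; rewrite Cmap_fixed; have /ceqv_fixed/(_ y ny) -> := e.
  by rewrite cmap_cat -bd_fixed !coef_cat restrictK.
have [||a' [_ e']] := inj n (restrict a) I.
- by apply/scycle_fixed; apply: scycle_ceqv ca => x nx; rewrite restrictK.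
- exists (restrict b'); split=> //; apply/ceqv_fixed => y ny.
  rewrite -Cmap_fixed -bd_fixed (Cmap_ceqv (restrictK sa) ny) e //.
  by rewrite (bd_ceqv (restrictK sb')).
exists (cmap (@proj1_sig _ _) a'); split; first exact: supp_fixed.
move=> x nx; rewrite -restrictK //; have /ceqv_fixed/(_ x nx) -> := e'.
by rewrite bd_fixed.
Qed.

End FixedSimplices.

Theorem theorem2p17 (G : grp) (F : (G -> Prop) -> Prop)
  (HF : forall H, F H -> is_subgroup H)
  (R : comPzRingType) (X Y : sGset G) (f : sGmap X Y)
  (stabX : forall n (x : sim X n), F (stab x))
  (stabY : forall n (y : sim Y n), F (stab y)) :
  ((forall H, F H ->
      @quasi_iso_sub R X Y (@inv_chain R G X H) (@inv_chain R G Y H)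
        (@Cmap R X Y f)) ->
   @equiv_htpy_equivalence R G X Y f) /\
  ((forall H, F H ->
      @quasi_iso R (fixX X H) (fixX Y H) (@Cmap R _ _ (@fixmap G X Y f H))) ->
   @equiv_htpy_equivalence R G X Y f).
Proof.
split=> quasi.
  (* On [simplex_basis] the family [inv] unfolds to [inv_chain], so the hypothesis of (a) fits as it
     stands. *)
  exact: equivalence_of_family (inv_family G R) stabX stabY quasi.
apply: equivalence_of_family (supp_family G R) stabX stabY _ => H /quasi.
exact: quasi_iso_fixed.
Qed.
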